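(* The symmetric inverse semigroup $I(\mathbb{N})$, with the topology $\tau_{pp}$, does not have the Pettis property.
   Context: $I(\mathbb{N})$ is the set of all bijections $f:A\to B$ with $A,B\subseteq\mathbb{N}$ (including the empty function $1_\emptyset$); write $\mathrm{dom}(f)=A$, $\mathrm{im}(f)=B$. The operation is composition of partial functions: $\mathrm{dom}(f\circ g)=g^{-1}(\mathrm{dom}(f)\cap\mathrm{im}(g))$ and $(f\circ g)(x)=f(g(x))$. It is an inverse semigroup, the inverse of $f$ being the inverse function $f^{-1}:B\to A$. The topology $\tau_{pp}$ on $I(\mathbb{N})$ is generated (as a subbase) by the sets $v(x,y)=\{f: x\in\mathrm{dom}(f),\ f(x)=y\}$, $w_1(x)=\{f: x\notin\mathrm{dom}(f)\}$, $w_2(y)=\{f: y\notin\mathrm{im}(f)\}$ for $x,y\in\mathbb{N}$; with it, $I(\mathbb{N})$ is a Polish topological inverse semigroup (composition and inversion are continuous). A subset $A$ of a topological space has the Baire property if there is an open set $V$ such that the symmetric difference $A\triangle V$ is meager. A topological inverse semigroup $S$ has the Pettis property if for every non-meager $A\subseteq S$ with the Baire property there are an idempotent $e\in S$ and an open set $V\subseteq S$ such that $e\in V$ and $V\subseteq A^{-1}A$, where $A^{-1}A=\{a^{-1}b: a,b\in A\}$ and $a^{-1}$ is the (unique) inverse of $a$ in $S$. *)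

(* Defs.v *)
From HB Require Import structures.
From mathcomp Require Import all_boot finmap.
From mathcomp Require Import boolp classical_sets functions topology.

Set Implicit Arguments.
Unset Strict Implicit.
Unset Printing Implicit Defensive.

Local Open Scope classical_set_scope.

Section BaireProperty.
Variable T : topologicalType.
Implicit Types A : set T.

Definition nowhere_dense A := interior (closure A) = set0.

Definition meager A :=
  exists2 F : nat -> set T,
    (forall n, nowhere_dense (F n)) & A = \bigcup_n F n.

Definition Baire_property A :=
  exists2 V : set T, open V & meager (A `+` V).

End BaireProperty.

HB.mixin Record Semigroup_isInverseSemigroup S of Semigroup S := {
  sinv : S -> S;
  sinv_regl : forall a : S, (a * sinv a * a)%g = a;
  sinv_regr : forall a : S, (sinv a * a * sinv a)%g = sinv a;
  sinv_uniq : forall a b : S,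
    (a * b * a)%g = a -> (b * a * b)%g = b -> b = sinv a
}.

#[short(type="inverseSemigroupType")]
HB.structure Definition InverseSemigroup :=
  {S of Semigroup_isInverseSemigroup S & Semigroup S}.

HB.structure Definition PreTopologicalInverseSemigroup :=
  {S of Topological S & InverseSemigroup S}.

HB.mixin Record isTopologicalInverseSemigroup S
    of PreTopologicalInverseSemigroup S := {
  mulg_continuous : continuous (fun x : S * S => (x.1 * x.2)%g);
  sinv_continuous : continuous (sinv : S -> S)
}.

#[short(type="topologicalInverseSemigroupType")]
HB.structure Definition TopologicalInverseSemigroup :=
  {S of PreTopologicalInverseSemigroup S & isTopologicalInverseSemigroup S}.

Definition Pettis_property (S : topologicalInverseSemigroupType) :=
  forall A : set S, ~ meager A -> Baire_property A ->
    exists (e : S) (V : set S),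
      [/\ (e * e)%g = e, open V, V e &
          V `<=` [set (sinv a * b)%g | a in A & b in A]].

(* A bijection between two subsets of nat is encoded as an injective partial
   function: [None] means "undefined", and the two subsets are [pbij_dom] and
   [pbij_im] below (see [pbij_set_bij] and [set_bij_pbij]). *)
Record pbij := Pbij {
  pbij_fun :> nat -> option nat;
  pbij_inj : forall x x' y,
    pbij_fun x = Some y -> pbij_fun x' = Some y -> x = x'
}.

HB.instance Definition _ := gen_eqMixin pbij.
HB.instance Definition _ := gen_choiceMixin pbij.

Definition pbij_dom (f : pbij) : set nat := [set x | exists y, f x = Some y].
Definition pbij_im (f : pbij) : set nat := [set y | exists x, f x = Some y].

Lemma pbijP (f g : pbij) : f =1 g -> f = g.
Proof.
case: f g => [f fi] [g gi] /= /funext fg; subst g.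
by congr Pbij; exact: Prop_irrelevance.
Qed.

Lemma pbij_domPn (f : pbij) x : ~ pbij_dom f x <-> f x = None.
Proof.
split=> [|fx [y]]; last by rewrite fx.
by case fx : (f x) => [y|//] []; exists y.
Qed.

Lemma pbij_set_bij (f : pbij) : exists2 g : nat -> nat,
  set_bij (pbij_dom f) (pbij_im f) g &
  forall x, pbij_dom f x -> f x = Some (g x).
Proof.
exists (fun x => odflt 0%N (f x)); last by move=> x [y ->].
split=> [x [y fx]|x x'|y [x fx]] /=.
- by exists x; rewrite fx.
- rewrite !inE => -[y fx] [y' fx']; rewrite fx fx' /= => yy'.
  by apply: (pbij_inj fx); rewrite yy'.
- by exists x; [exists y|rewrite fx].
Qed.

Lemma set_bij_pbij (A B : set nat) (g : nat -> nat) : set_bij A B g ->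
  exists f : pbij, [/\ pbij_dom f = A, pbij_im f = B &
    forall x, A x -> f x = Some (g x)].
Proof.
move=> [gAB ginj gsurj].
have fi x x' y : (if `[< A x >] then Some (g x) else None) = Some y ->
    (if `[< A x' >] then Some (g x') else None) = Some y -> x = x'.
  case: asboolP => // Ax [gx]; case: asboolP => // Ax' [gx'].
  by apply: ginj; rewrite ?inE // gx gx'.
exists (Pbij fi); split.
- apply/seteqP; split=> [x [y] /=|x Ax]; first by case: asboolP.
  by exists (g x) => /=; case: asboolP.
- apply/seteqP; split=> [y [x] /=|y /gsurj[x Ax <-]].
    by case: asboolP => // Ax [<-]; exact: gAB.
  by exists x => /=; case: asboolP.
- by move=> x Ax /=; case: asboolP.
Qed.

Section Composition.
Variables f g : pbij.

Let comp_fun x := obind f (g x).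

Let comp_inj x x' y :
  comp_fun x = Some y -> comp_fun x' = Some y -> x = x'.
Proof.
rewrite /comp_fun; case gx : (g x) => [z|//] /= fz.
case gx' : (g x') => [z'|//] /= fz'.
by apply: (pbij_inj gx); rewrite gx' (pbij_inj fz fz').
Qed.

Definition pbij_comp := Pbij comp_inj.

End Composition.

Lemma pbij_compP f g x y :
  pbij_comp f g x = Some y <-> exists2 z, g x = Some z & f z = Some y.
Proof.
rewrite /=; split=> [|[z -> //]].
by case: (g x) => [z|//] /= fz; exists z.
Qed.

Lemma pbij_dom_comp f g : pbij_dom (pbij_comp f g) =
  [set x | exists2 y, g x = Some y & (pbij_dom f `&` pbij_im g) y].
Proof.
apply/seteqP; split=> [x [y /pbij_compP[z gx fz]]|x [z gx [[y fz] _]]].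
  by exists z => //; split; [exists y|exists x].
by exists y; apply/pbij_compP; exists z.
Qed.

Section Inverse.
Variable f : pbij.

Let inv_fun y : option nat :=
  if pselect (exists x, f x == Some y) is left e then Some (xchoose e) else None.

Let inv_funP x y : inv_fun y = Some x <-> f x = Some y.
Proof.
rewrite /inv_fun; case: pselect => [e|ne]; split=> //.
- by move=> [<-]; exact/eqP/(xchooseP e).
- by move=> fx; congr Some; apply: pbij_inj fx; exact/eqP/(xchooseP e).
- by move=> fx; case: ne; exists x; apply/eqP.
Qed.

Let inv_inj y y' x : inv_fun y = Some x -> inv_fun y' = Some x -> y = y'.
Proof. by move=> /inv_funP fx /inv_funP; rewrite fx => -[]. Qed.

Definition pbij_inv := Pbij inv_inj.

Lemma pbij_invP x y : pbij_inv y = Some x <-> f x = Some y.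
Proof. exact: inv_funP. Qed.

End Inverse.

Lemma pbij_compA : associative pbij_comp.
Proof. by move=> f g h; apply: pbijP => x /=; case: (h x). Qed.

HB.instance Definition _ := isSemigroup.Build pbij pbij_compA.

Lemma pbij_eqP (f g : pbij) :
  (forall x y, f x = Some y <-> g x = Some y) -> f = g.
Proof.
move=> fg; apply: pbijP => x.
case fx : (f x) => [y|]; first by have /fg -> := fx.
by case gx : (g x) => [y|//]; have /fg := gx; rewrite fx.
Qed.

Lemma pbij_inv_regl (f : pbij) : (f * pbij_inv f * f)%g = f.
Proof.
apply: pbij_eqP => x y; split.
  move=> /pbij_compP[z fx /pbij_compP[t /pbij_invP ft]].
  by rewrite -(pbij_inj fx ft).
move=> fx; apply/pbij_compP; exists y => //.
by apply/pbij_compP; exists x => //; exact/pbij_invP.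
Qed.

Lemma pbij_invK : involutive pbij_inv.
Proof.
move=> f; apply: pbij_eqP => x y.
by split=> [/pbij_invP/pbij_invP|fx] //; do 2 apply/pbij_invP.
Qed.

Lemma pbij_inv_regr (f : pbij) : (pbij_inv f * f * pbij_inv f)%g = pbij_inv f.
Proof. by have := pbij_inv_regl (pbij_inv f); rewrite pbij_invK. Qed.

Lemma pbij_inv_uniq (f g : pbij) :
  (f * g * f)%g = f -> (g * f * g)%g = g -> g = pbij_inv f.
Proof.
have half (h k : pbij) x y : (h * k * h)%g = h -> h x = Some y -> k y = Some x.
  move=> hkh hx; have := hx; rewrite -[X in pbij_fun X]hkh.
  move=> /pbij_compP[y' + /pbij_compP[x' ky' hx']].
  rewrite hx => -[yy']; rewrite -yy' in ky'.
  by rewrite ky' (pbij_inj hx hx').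
move=> fgf gfg; apply: pbij_eqP => y x; split.
  by move=> /(half _ _ _ _ gfg) fx; exact/pbij_invP.
by move=> /pbij_invP/(half _ _ _ _ fgf).
Qed.

HB.instance Definition _ := Semigroup_isInverseSemigroup.Build pbij
  pbij_inv_regl pbij_inv_regr pbij_inv_uniq.

Definition pbij_v (x y : nat) : set pbij := [set f : pbij | f x = Some y].
Definition pbij_w1 (x : nat) : set pbij := [set f | ~ pbij_dom f x].
Definition pbij_w2 (y : nat) : set pbij := [set f | ~ pbij_im f y].

Definition tau_pp_subbase : set (set pbij) :=
  [set U | [\/ exists x y, U = pbij_v x y,
               exists x, U = pbij_w1 x |
               exists y, U = pbij_w2 y]].

HB.instance Definition _ := isSubBaseTopological.Build pbij tau_pp_subbase id.

Lemma tau_pp_subbase_open (U : set pbij) : tau_pp_subbase U -> open U.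
Proof.
move=> DU; exists [set U]; last by rewrite bigcup_set1.
move=> _ ->; exists [fset U]%fset; last by rewrite set_fset1 bigcap_set1.
by move=> V /fset1P ->; rewrite inE.
Qed.

Lemma pbij_v_open x y : open (pbij_v x y).
Proof. by apply: tau_pp_subbase_open; apply: Or31; exists x, y. Qed.

Lemma pbij_w1_open x : open (pbij_w1 x).
Proof. by apply: tau_pp_subbase_open; apply: Or32; exists x. Qed.

Lemma pbij_w2_open y : open (pbij_w2 y).
Proof. by apply: tau_pp_subbase_open; apply: Or33; exists y. Qed.

Lemma tau_pp_cvg (F : set_system pbij) (f : pbij) : Filter F ->
  (forall x y, pbij_v x y f -> F (pbij_v x y)) ->
  (forall x, pbij_w1 x f -> F (pbij_w1 x)) ->
  (forall y, pbij_w2 y f -> F (pbij_w2 y)) -> F --> f.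
Proof.
move=> FF Fv Fw1 Fw2 A; rewrite nbhsE => -[_ [[B sB <-] [C BC Cf]] sUBA].
rewrite nbhs_filterE; apply: filterS sUBA _; apply: (@filterS _ _ _ C).
  by move=> ? ?; exists C.
have /sB [D sD IDeC] := BC; rewrite -IDeC; apply: filter_bigI => E DE.
have Ef : E f by move: Cf; rewrite -IDeC => /(_ _ DE).
have := sD _ DE; rewrite inE => -[[x [y EE]]|[x EE]|[y EE]]; subst E.
- exact: Fv.
- exact: Fw1.
- exact: Fw2.
Qed.

Lemma nbhs_prod (f g : pbij) (U V : set pbij) (W : set (pbij * pbij)) :
  open U -> open V -> U f -> V g -> (forall f' g', U f' -> V g' -> W (f', g')) ->
  nbhs (f, g) W.
Proof.
move=> oU oV Uf Vg UVW; exists (U, V); last by move=> [f' g'] [] /=; exact: UVW.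
by split; apply: open_nbhs_nbhs.
Qed.

Lemma pbij_mul_continuous :
  continuous (fun p : pbij * pbij => (p.1 * p.2)%g : pbij).
Proof.
move=> [f g]; apply: tau_pp_cvg.
- move=> x y /pbij_compP[z gx fz].
  apply: (nbhs_prod (pbij_v_open z y) (pbij_v_open x z) fz gx) => f' g' f'z g'x.
  by apply/pbij_compP; exists z.
- move=> x /pbij_domPn /=; case gx : (g x) => [z|] /= => [fz|_].
    have /pbij_domPn fz' := fz.
    apply: (nbhs_prod (pbij_w1_open z) (pbij_v_open x z) fz' gx).
    move=> f' g' f'z g'x [y /pbij_compP[z']]; rewrite g'x => -[<-] f'y.
    by apply: f'z; exists y.
  have /pbij_domPn gx' := gx.
  apply: (nbhs_prod openT (pbij_w1_open x) I gx') => f' g' _ g'x.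
  by move=> [y /pbij_compP[z g'z _]]; apply: g'x; exists z.
- move=> y /= fgy; have [[z fz]|fy] := pselect (pbij_im f y).
    have gz : ~ pbij_im g z.
      by move=> [x gx]; apply: fgy; exists x; apply/pbij_compP; exists z.
    apply: (nbhs_prod (pbij_v_open z y) (pbij_w2_open z) fz gz).
    move=> f' g' f'z g'z [x /pbij_compP[z' g'x f'z']]; apply: g'z; exists x.
    by rewrite g'x (pbij_inj f'z' f'z).
  apply: (nbhs_prod (pbij_w2_open y) openT fy I) => f' g' f'y _.
  by move=> [x /pbij_compP[z _ f'z]]; apply: f'y; exists z.
Qed.

Lemma pbij_inv_continuous : continuous pbij_inv.
Proof.
move=> f; apply: (@tau_pp_cvg _ _ (fmap_filter _ (nbhs_filter f))).
- move=> x y /pbij_invP fy.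
  apply: (@filterS _ _ (nbhs_filter f)) (open_nbhs_nbhs (conj (pbij_v_open y x) fy)) => f' f'y.
  exact/pbij_invP.
- move=> x fx; have fx' : pbij_w2 x f.
    by move=> [y fy]; apply: fx; exists y; exact/pbij_invP.
  apply: (@filterS _ _ (nbhs_filter f)) (open_nbhs_nbhs (conj (pbij_w2_open x) fx')) => f' f'x.
  by move=> [y /pbij_invP f'y]; apply: f'x; exists y.
- move=> y fy; have fy' : pbij_w1 y f.
    by move=> [x fx]; apply: fy; exists x; exact/pbij_invP.
  apply: (@filterS _ _ (nbhs_filter f)) (open_nbhs_nbhs (conj (pbij_w1_open y) fy')) => f' f'y.
  by move=> [x /pbij_invP f'x]; apply: f'y; exists x.
Qed.

HB.instance Definition _ := isTopologicalInverseSemigroup.Build pbij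
  pbij_mul_continuous pbij_inv_continuous.

(* Main.v *)
From mathcomp Require Import all_boot.
From mathcomp Require Import boolp classical_sets topology.
Require Import Defs.

(** A generic partial bijection has a coinfinite domain, so the set [A] of
    partial bijections with coinfinite domain is comeager; it is not meager
    because the topology satisfies the Baire category theorem. Every element of
    [A^-1 A] has a domain contained in the domain of an element of [A], hence
    coinfinite, whereas every neighbourhood of an idempotent contains a partial
    bijection that is the identity on a final segment of [nat]. *)

Set Implicit Arguments.
Unset Strict Implicit.
Unset Printing Implicit Defensive.

Local Open Scope classical_set_scope.

Lemma meagerU (T : topologicalType) (A B : set T) :
  meager A -> meager B -> meager (A `|` B).
Proof.
move=> [F ndF ->] [G ndG ->].
exists (fun n => if odd n then F n./2 else G n./2).
  by move=> n; case: ifP.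
apply/seteqP; split=> x.
  move=> [[n _ Fx]|[n _ Gx]].
    by exists n.*2.+1 => //=; rewrite odd_double /= uphalf_double.
  by exists n.*2 => //=; rewrite odd_double doubleK.
by move=> [n _]; case: ifP => _ ?; [left|right]; exists n./2.
Qed.

(** These sets form a neighbourhood base at [f]. Inverses are compared as well, since [pbij_w2]
    constrains images. *)
Definition pbij_ball (f : pbij) (n : nat) : set pbij :=
  [set g : pbij | forall x, x < n -> g x = f x /\ pbij_inv g x = pbij_inv f x].

Lemma pbij_ball_trans f g h m n : m <= n ->
  pbij_ball f m g -> pbij_ball g n h -> pbij_ball f m h.
Proof.
move=> mn fg gh x xm; have [<- <-] := fg x xm.
exact: gh (leq_trans xm mn).
Qed.

Lemma pbij_eq_at_open (f : pbij) x : open [set g : pbij | g x = f x].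
Proof.
case fx : (f x) => [y|]; first exact: pbij_v_open.
rewrite (_ : mkset _ = pbij_w1 x); first exact: pbij_w1_open.
by apply/seteqP; split=> g /pbij_domPn.
Qed.

Lemma pbij_ball_open f n : open (pbij_ball f n).
Proof.
elim: n => [|n IHn].
  by rewrite (_ : pbij_ball f 0 = setT); [exact: openT|apply/seteqP; split].
have -> : pbij_ball f n.+1 = pbij_ball f n `&` ([set g : pbij | g n = f n] `&`
    pbij_inv @^-1` [set g : pbij | g n = pbij_inv f n]).
  apply/seteqP; split=> [g fg|g [fg fgn] x].
    by split; [move=> x xn; exact: fg (ltnW xn)|exact: fg].
  by rewrite ltnS leq_eqVlt => /predU1P[->|/fg].
apply: openI => //; apply: openI; first exact: pbij_eq_at_open.
by apply: open_comp (pbij_eq_at_open _ _) => g _; exact: pbij_inv_continuous.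
Qed.

Lemma open_pbij_ball (U : set pbij) f : open U -> U f ->
  exists n, pbij_ball f n `<=` U.
Proof.
move=> oU Uf; pose F := filter_from [set: nat] (pbij_ball f).
have FF : Filter F.
  apply: filter_from_filter; first by exists 0.
  move=> i j _ _; exists (maxn i j) => // g fg.
  by split; apply: pbij_ball_trans fg; rewrite ?leq_maxl ?leq_maxr.
suff : F --> f.
  move=> /(_ U) [|n _ fU]; last by exists n.
  exact: open_nbhs_nbhs.
apply: tau_pp_cvg.
- by move=> x y fx; exists x.+1 => // g /(_ x (ltnSn x)) [+ _]; rewrite fx.
- move=> x /pbij_domPn fx; exists x.+1 => // g /(_ x (ltnSn x)) [gx _].
  by apply/pbij_domPn; rewrite gx.
- move=> y fy; exists y.+1 => // g /(_ y (ltnSn y)) [_ gfy] [x /pbij_invP].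
  by rewrite gfy => /pbij_invP fx; apply: fy; exists x.
Qed.

(** Inductive step of the Baire category argument; [n < m] makes the radii grow, so that nested
    balls determine a limit. *)
Lemma pbij_ball_avoid (F : set pbij) f n : nowhere_dense F ->
  exists g m, [/\ n < m, pbij_ball f n g & pbij_ball g m `<=` ~` F].
Proof.
move=> ndF.
have : ~ (pbij_ball f n `<=` closure F).
  move=> sub; have : interior (closure F) f.
    by apply: interiorS sub _ _; apply: open_nbhs_nbhs; split => //;
      exact: pbij_ball_open.
  by rewrite ndF.
move=> /existsNP[g /not_implyP[fg ncFg]].
have oC : open (~` closure F) by exact/closed_openC/closed_closure.
have [m gm] := open_pbij_ball oC ncFg.
exists g, (maxn m n.+1); split => //; first exact: leq_maxr.
move=> h gh Fh; apply: (gm h); last exact: subset_closure.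
by apply: pbij_ball_trans gh => //; exact: leq_maxl.
Qed.

(** Completeness: as [k <= n k], the value at [x] is constant from step [x.+1] on, and this value
    defines the limit. *)
Lemma pbij_ball_limit (f : nat -> pbij) (n : nat -> nat) :
  (forall k, n k < n k.+1) -> (forall k, pbij_ball (f k) (n k) (f k.+1)) ->
  exists g, forall k, pbij_ball (f k) (n k) g.
Proof.
move=> n_lt f_ball.
have n_homo : {homo n : i j / i <= j}.
  by apply: homo_leq => // [i j k|k]; [exact: leq_trans|exact: ltnW].
have n_ge k : k <= n k by elim: k => // k IHk; exact: leq_ltn_trans (n_lt k).
have f_le i j : i <= j -> pbij_ball (f i) (n i) (f j).
  elim: j => [|j IHj]; first by rewrite leqn0 => /eqP ->.
  rewrite leq_eqVlt => /predU1P[<- //|]; rewrite ltnS => ij.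
  exact: pbij_ball_trans (n_homo _ _ ij) (IHj ij) (f_ball j).
have f_ev x i : x < i -> f x.+1 x = f i x.
  by move=> xi; have [] := f_le _ _ xi x (n_ge _).
have g_inj x x' y : f x.+1 x = Some y -> f x'.+1 x' = Some y -> x = x'.
  rewrite (@f_ev x (maxn x x').+1) ?ltnS ?leq_maxl//.
  rewrite (@f_ev x' (maxn x x').+1) ?ltnS ?leq_maxr//.
  exact: pbij_inj.
pose g := Pbij g_inj; exists g => k.
have gE x i : x < i -> g x = f i x by exact: f_ev.
move=> x xk; split.
  rewrite (gE x (maxn k x.+1)) ?leq_maxr//.
  by have [] := f_le _ _ (leq_maxl k x.+1) x xk.
(* The preimage [z] of [x] may lie beyond [n k]; at an index above both [k] and [z], the term agrees
   with [g] at [z] and its inverse with that of [f k] at [x]. *)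
case e : (pbij_inv (f k) x) => [z|].
  apply/pbij_invP; rewrite (gE z (maxn k z.+1)) ?leq_maxr//.
  by apply/pbij_invP; rewrite -e; have [] := f_le _ _ (leq_maxl k z.+1) x xk.
case e' : (pbij_inv g x) => [z|//]; move/pbij_invP : e'.
rewrite (gE z (maxn k z.+1)) ?leq_maxr// => /pbij_invP <-.
by rewrite -e; have [] := f_le _ _ (leq_maxl k z.+1) x xk.
Qed.

Lemma pbij_baire : ~ meager [set: pbij].
Proof.
move=> [F ndF FT].
(* From an index [i] and a ball (centre, radius), [s] chooses a smaller ball inside it that misses
   [F i]. *)
have [s sP] := @choice (nat * (pbij * nat)) (pbij * nat)
  (fun p q => [/\ p.2.2 < q.2, pbij_ball p.2.1 p.2.2 q.1 &
                  pbij_ball q.1 q.2 `<=` ~` F p.1])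
  (fun p => let: ex_intro g (ex_intro m H) :=
     pbij_ball_avoid p.2.1 p.2.2 (ndF p.1) in ex_intro _ (g, m) H).
have id_inj (x x' y : nat) : Some x = Some y -> Some x' = Some y -> x = x'.
  by move=> [->] [->].
pose u := fix u k := if k is j.+1 then s (j, u j) else (@Pbij (@Some nat) id_inj, 0).
have uP k := sP (k, u k).
have [g gP] : exists g, forall k, pbij_ball (u k).1 (u k).2 g.
  by apply: pbij_ball_limit => k; have [] := uP k.
have : [set: pbij] g by [].
rewrite FT => -[k _]; have [_ _] := uP k; apply; exact: gP k.+1.
Qed.

Definition pbij_dom_coinfinite : set pbij :=
  [set f : pbij | forall n, exists2 x, n <= x & f x = None].

(** The set is closed, and it contains no ball because deleting one large point from the domain of
    the centre stays in the ball. *)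
Lemma nowhere_dense_dom_ge n :
  nowhere_dense [set f : pbij | forall x, n <= x -> pbij_dom f x].
Proof.
set D := mkset _.
have cD : closed D.
  rewrite -openC (_ : ~` D = \bigcup_(x in [set x | n <= x]) pbij_w1 x).
    by apply: bigcup_open => x _; exact: pbij_w1_open.
  apply/seteqP; split=> f.
    by move=> /existsNP[x /not_implyP[nx fx]]; exists x.
  by move=> [x nx fx] /(_ x nx).
rewrite /nowhere_dense -(closure_id D).1 //.
rewrite -subset0 => f intf.
have [m fm] := open_pbij_ball (open_interior D) intf.
(* The point to delete: [k >= m] keeps the values below [m], exceeding every preimage of a [y < m]
   keeps the inverse there, and [k >= n] forces [g] out of [D]. The default 0 for a missing preimage
   is harmless. *)
pose k := maxn (maxn m n) (\max_(y < m) odflt 0 (pbij_inv f y)).+1.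
have g_inj x x' y : (if x == k then None else f x) = Some y ->
    (if x' == k then None else f x') = Some y -> x = x'.
  by case: eqP => // _; case: eqP => // _; exact: pbij_inj.
pose g := Pbij g_inj.
have : D g.
  apply: interior_subset; apply: fm => y ym; split.
    by rewrite /= ltn_eqF// (leq_trans ym)// /k -maxnA leq_maxl.
  case e : (pbij_inv f y) => [x|].
    apply/pbij_invP => /=; rewrite ltn_eqF; first exact/pbij_invP.
    rewrite /k leq_max ltnS; apply/orP; right.
    have -> : x = odflt 0 (pbij_inv f (Ordinal ym)) by rewrite e.
    exact: (leq_bigmax (F := fun y : 'I_m => odflt 0 (pbij_inv f y))).
  case e' : (pbij_inv g y) => [x|//]; move/pbij_invP : e' => /=.
  by case: eqP => // _ /pbij_invP; rewrite e.
move=> /(_ k); rewrite {1}/k !leq_max leqnn orbT => /(_ isT).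
by apply/pbij_domPn; rewrite /= eqxx.
Qed.

Lemma meager_setC_dom_coinfinite : meager (~` pbij_dom_coinfinite).
Proof.
exists (fun n => [set f : pbij | forall x, n <= x -> pbij_dom f x]).
  exact: nowhere_dense_dom_ge.
apply/seteqP; split=> f.
  move=> /existsNP[n nf]; exists n => // x nx.
  by apply: contrapT => /pbij_domPn fx; apply: nf; exists x.
move=> [n _ fn] /(_ n)[x nx fx]; have := fn x nx.
by move/pbij_domPn : fx.
Qed.

(** Idempotency gives [e y = Some y], and injectivity then identifies [x] with [y]. *)
Lemma pbij_idempotent_eq (e : pbij) x y : (e * e)%g = e -> e x = Some y -> x = y.
Proof.
move=> ee ex; have := ex; rewrite -[X in pbij_fun X]ee => /pbij_compP[z].
by rewrite ex => -[<-] ey; exact: (pbij_inj ex ey).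
Qed.

(** An idempotent is a partial identity, so replacing it by the identity from [n] on keeps it
    injective and changes neither it nor its inverse below [n]. *)
Lemma pbij_ball_idempotent_cofinal (e : pbij) n : (e * e)%g = e ->
  exists2 g, pbij_ball e n g & forall x, n <= x -> g x = Some x.
Proof.
move=> ee; pose gf x := if x < n then e x else Some x.
have gfE x y : gf x = Some y -> x = y.
  by rewrite /gf; case: ifP => _; [exact: pbij_idempotent_eq|case].
have g_inj x x' y : gf x = Some y -> gf x' = Some y -> x = x'.
  by move=> /gfE -> /gfE ->.
exists (Pbij g_inj); last by move=> x nx; rewrite /= /gf ltnNge nx.
move=> y yn; split; first by rewrite /= /gf yn.
case E : (pbij_inv e y) => [x|].
  move/pbij_invP : E => ex; apply/pbij_invP => /=.
  by rewrite /gf (pbij_idempotent_eq ee ex) yn -[in LHS](pbij_idempotent_eq ee ex).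
case E' : (pbij_inv _ y) => [x|//]; move/pbij_invP : E' => /= gx.
have xy := gfE _ _ gx; move: gx; rewrite /gf xy yn => /pbij_invP.
by rewrite E.
Qed.

Theorem corollary5p5 : ~ Pettis_property pbij.
Proof.
move=> pettis; have mAC := meager_setC_dom_coinfinite.
have [||e [V [ee oV Ve VA]]] := pettis pbij_dom_coinfinite.
- move=> mA; apply: pbij_baire.
  by rewrite -(setUv pbij_dom_coinfinite); exact: meagerU.
(* The symmetric difference with the whole space is the complement, already known to be meager. *)
- by exists setT; [exact: openT|rewrite setYTC].
have [n eV] := open_pbij_ball oV Ve.
have [g eg gid] := pbij_ball_idempotent_cofinal n ee.
have [a _ [b Ab abg]] := VA g (eV g eg).
(* In the product [b] acts first, so a point [x >= n] where [b] is undefined contradicts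
   [g x = Some x]. *)
have [x nx bx] := Ab n.
by have := gid x nx; rewrite -abg /= bx.
Qed.
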